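(* Let $m=2t+1\ge5$ and $n=\frac{3^m+1}{4}$. For every integer $\delta$ with $\delta_{2,n}+1\le\delta\le\delta_{1,n}$, the LCD BCH code $\mathcal{C}_{(n,3,\delta,1)}$ has parameters $[n,2m+1,d\ge\delta_{2,n}]$ and $\mathcal{C}_{(n,3,\delta+1,0)}$ has parameters $[n,2m,d\ge2\delta_{2,n}]$.
   Context: Let $q$ be a prime power and $n\ge2$ an integer with $\gcd(n,q)=1$. Let $\ell=\mathrm{ord}_n(q)$, let $\alpha$ be a generator of $\mathbb{F}_{q^\ell}^*$, $\beta=\alpha^{(q^\ell-1)/n}$, and let $m_i(x)$ be the minimal polynomial of $\beta^i$ over $\mathbb{F}_q$. For integers $b\ge0$ and $2\le\delta\le n$, $\mathcal{C}_{(n,q,\delta,b)}$ denotes the cyclic (BCH) code of length $n$ over $\mathbb{F}_q$ with generator polynomial $\mathrm{lcm}(m_b(x),\dots,m_{b+\delta-2}(x))$. A linear code $\mathcal{C}$ is LCD if $\mathcal{C}\cap\mathcal{C}^\perp=\{0\}$ (Euclidean dual). $[n,k,d\ge D]$ means length $n$, dimension $k$, minimum Hamming distance at least $D$. For $0\le s\le n-1$, $C_s=\{sq^i\bmod n:0\le i\le\ell-1\}$ is the $q$-cyclotomic coset of $s$ modulo $n$; its least element is its coset leader; $\mathrm{MinRep}_n$ is the set of coset leaders modulo $n$ (including $0$), and $\delta_{i,n}$ is the $i$-th largest element of $\mathrm{MinRep}_n$ (here with $q=3$). *)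

(* Defs.v *)
From HB Require Import structures.
From mathcomp Require Import all_boot all_order all_algebra all_field.
Set Implicit Arguments. Unset Strict Implicit. Unset Printing Implicit Defensive.
Import Order.TTheory GRing.Theory Num.Theory.

(* ord_n(q): least k > 0 with q^k = 1 mod n (found among 0..n, which suffices
   when gcd(n,q)=1 and n >= 2). *)
Definition ordn (n q : nat) : nat :=
  find (fun k => (0 < k) && (q ^ k %% n == 1 %% n)) (iota 0 n.+1).

Definition cyc_coset (n q s : nat) : seq nat :=
  [seq s * q ^ i %% n | i <- iota 0 (ordn n q)].

Definition coset_leader (n q s : nat) : bool :=
  (s < n) && all (fun x => s <= x) (cyc_coset n q s).

Definition MinRep (n q : nat) : seq nat := [seq s <- iota 0 n | coset_leader n q s].

Definition delta_ (i n q : nat) : nat := nth 0 (sort geq (MinRep n q)) i.-1.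

Local Open Scope ring_scope.

Definition is_minpoly (F L : fieldType) (iota : {rmorphism F -> L}) (x : L)
    (p : {poly F}) : Prop :=
  [/\ p \is monic, root (map_poly iota p) x &
      forall r : {poly F}, r != 0 -> root (map_poly iota r) x -> (size p <= size r)%N].

(* lcm of polynomials (up to a nonzero constant, irrelevant for divisibility) *)
Definition lcmp (F : fieldType) (p r : {poly F}) : {poly F} := (p * r) %/ gcdp p r.
Definition lcm_seq (F : fieldType) (s : seq {poly F}) : {poly F} := foldr (@lcmp F) 1 s.

Definition word_poly (F : fieldType) (n : nat) (c : 'rV[F]_n) : {poly F} :=
  \sum_(i < n) c 0 i *: 'X^i.

Definition cyclic_code (F : finFieldType) (n : nat) (g : {poly F}) : {set 'rV[F]_n} :=
  [set c : 'rV[F]_n | g %| word_poly c].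

Definition bch_code (F : finFieldType) (n : nat) (mp : nat -> {poly F})
    (delta b : nat) : {set 'rV[F]_n} :=
  cyclic_code n (lcm_seq [seq mp i | i <- iota b (delta - 1)]).

Definition dotw (F : fieldType) (n : nat) (x y : 'rV[F]_n) : F :=
  \sum_(i < n) x 0 i * y 0 i.

Definition dual_code (F : finFieldType) (n : nat) (C : {set 'rV[F]_n}) : {set 'rV[F]_n} :=
  [set y | [forall x in C, dotw x y == 0]].

Definition is_LCD (F : finFieldType) (n : nat) (C : {set 'rV[F]_n}) : Prop :=
  C :&: dual_code C = [set 0].

Definition wt (F : fieldType) (n : nat) (c : 'rV[F]_n) : nat := #|[set i | c 0 i != 0]|.

(* C (a linear code, being a cyclic code) has dimension k over F *)
Definition has_dim (F : finFieldType) (n : nat) (C : {set 'rV[F]_n}) (k : nat) : Prop :=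
  #|C| = (#|F| ^ k)%N.

Definition min_dist_ge (F : finFieldType) (n : nat) (C : {set 'rV[F]_n}) (D : nat) : Prop :=
  forall c, c \in C -> c != 0 -> (D <= wt c)%N.

(* Main.v *)
Require Import Defs.
From HB Require Import structures.
From mathcomp Require Import all_boot all_order all_algebra all_field.
From mathcomp Require Import zify ring.
Import GRing.Theory.

(** With [n = (3^m+1)/4] one has [n = 6D+1], and the largest coset leader is [D]:
    the coset of [D] contains [3D = (n-1)/2], hence the integers [(n +- 3^i)/2],
    while an orbit of multiplication by 3 staying strictly between [n/6] and
    [5n/6] is excluded by a congruence mod 4.  Since [6D = -1] mod [n], the coset
    of [D] has full size [2m].  For [delta_2 < delta <= D], the zeros of the two
    codes are therefore all [beta^s] except those with [s] in the coset of [D]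
    (and [s = 0] in the first case), which gives the dimensions.  As
    [3^m = -1] mod [n], the zero sets are stable under inversion, whence the LCD
    property, and [2 delta - 1] consecutive zeros in the second case. *)

(** * Cyclotomic cosets *)

Lemma ordn_unique (n q k : nat) :
  0 < k <= n -> q ^ k = 1 %[mod n] ->
  (forall j, 0 < j < k -> q ^ j <> 1 %[mod n]) -> ordn n q = k.
Proof.
move=> /andP[k0 kn] hk hlt; rewrite /ordn; set P := fun _ => _.
have kin : k < size (iota 0 n.+1) by rewrite size_iota.
have Pk : P k by rewrite /P k0 hk eqxx.
have hf : find P (iota 0 n.+1) < size (iota 0 n.+1).
  by rewrite -has_find; apply/hasP; exists k => //; rewrite mem_iota.
have fk : find P (iota 0 n.+1) <= k.
  rewrite leqNgt; apply/negP => /(before_find 0).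
  by rewrite nth_iota // add0n Pk.
have := nth_find 0 (s := iota 0 n.+1) (a := P); rewrite has_find => /(_ hf).
rewrite size_iota in hf; rewrite nth_iota // add0n => /andP[f0 /eqP ff].
apply/eqP; rewrite eqn_leq fk leqNgt; apply/negP => lt.
by apply: (hlt _ _ ff); rewrite f0.
Qed.

Lemma delta1_max (n q : nat) s : s \in MinRep n q -> s <= delta_ 1 n q.
Proof.
rewrite -(mem_sort geq) /delta_ /=.
have := sort_sorted (leT := geq) (fun x y => leq_total y x) (MinRep n q).
case: (sort _ _) => //= a l hp; rewrite inE => /orP[/eqP->//|sl].
have tr : transitive geq by move=> y x z /= h1 h2; exact: leq_trans h2 h1.
by have /allP := order_path_min tr hp; apply.
Qed.

Lemma delta1_mem (n q : nat) : MinRep n q != [::] -> delta_ 1 n q \in MinRep n q.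
Proof.
move=> h; rewrite -(mem_sort geq) /delta_; apply: mem_nth.
by rewrite size_sort lt0n size_eq0.
Qed.

Lemma delta2_max (n q : nat) s :
  s \in MinRep n q -> s != delta_ 1 n q -> s <= delta_ 2 n q.
Proof.
rewrite -(mem_sort geq) /delta_ /=.
have := sort_sorted (leT := geq) (fun x y => leq_total y x) (MinRep n q).
case: (sort _ _) => //= a [|b l] /=; first by rewrite inE => _ ->.
move=> /andP[_ hp]; rewrite !inE => /orP[->//|/orP[/eqP->//|sl]] _.
have tr : transitive geq by move=> y x z /= h1 h2; exact: leq_trans h2 h1.
by have /allP := order_path_min tr hp; apply.
Qed.

Lemma expn_mod_order (n q k i : nat) :
  q ^ k = 1 %[mod n] -> q ^ i = q ^ (i %% k) %[mod n].
Proof.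
move=> hk; rewrite [in LHS](divn_eq i k) expnD mulnC [i %/ k * k]mulnC expnM.
by rewrite -modnMmr -modnXm hk modnXm exp1n modnMmr muln1.
Qed.

Lemma mem_cyc_coset (n q s x : nat) :
  0 < ordn n q -> q ^ ordn n q = 1 %[mod n] ->
  reflect (exists i, x = s * q ^ i %% n) (x \in cyc_coset n q s).
Proof.
move=> M0 hM; apply: (iffP mapP) => [[i _ ->]|[i ->]]; first by exists i.
exists (i %% ordn n q); first by rewrite mem_iota /= ltn_mod.
by rewrite -modnMmr (expn_mod_order _ _ _ i hM) modnMmr.
Qed.

Lemma coset_leader_exists (n q s : nat) :
  0 < n -> 0 < ordn n q -> q ^ ordn n q = 1 %[mod n] ->
  exists2 r, r \in MinRep n q & exists j, s %% n = r * q ^ j %% n.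
Proof.
move=> n0 M0 hM.
have ex : exists x, x \in cyc_coset n q s.
  by exists (s * q ^ 0 %% n); apply/mem_cyc_coset => //; exists 0.
case: (ex_minnP ex) => r /mapP[i]; rewrite mem_iota add0n => /andP[_ iM] rE rmin.
exists r.
  have rn : r < n by rewrite rE ltn_mod.
  rewrite mem_filter; apply/andP; split; last by rewrite mem_iota.
  apply/andP; split => //.
  apply/allP => x /mem_cyc_coset - /(_ M0 hM)[j ->].
  apply: rmin; apply/mem_cyc_coset => //; exists (i + j).
  by rewrite rE modnMml expnD mulnA.
(* The minimum [r] is [s * q ^ i]; as [q] has order [ordn n q], this power undoes the factor [q ^ i]
   and leads back from [r] to [s]. *)
exists (ordn n q - i).
by rewrite rE modnMml -mulnA -expnD subnKC 1?ltnW // -modnMmr hM modnMmr muln1.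
Qed.

(** * Powers of 3 modulo (3^m+1)/4 *)

Lemma quarter_shape (m n : nat) : odd m -> 5 <= m -> 4 * n = 3 ^ m + 1 ->
  exists D, [/\ n = 6 * D + 1, 10 <= D & 3 ^ m.-1 = 8 * D + 1].
Proof.
move=> om m5 hn.
have [k mk] : exists k, m = k.*2 + 5.
  by exists (m - 5)./2; move: (odd_double_half m); rewrite om; lia.
have : exists2 D, 10 <= D & 3 ^ m.-1 = 8 * D + 1.
  (* The exponent [m.-1] is even, so induction goes by factors of 9: 81 = 8 * 10 + 1, and 9 (8D + 1)
     = 8 (9D + 1) + 1. *)
  rewrite mk addnS /= {om m5 hn mk m}; elim: k => [|k [D D10 IH]]; first by exists 10.
  by exists (9 * D + 1); rewrite ?doubleS ?addSn ?expnS ?IH; lia.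
case=> D D10 h; exists D; split => //.
by move: hn; rewrite -[m in 3 ^ m]prednK ?expnS ?h; lia.
Qed.

(** Multiplication by 3^m is negation modulo n, so the second half of a coset mirrors its first
    half. *)
Lemma expn3_half_order (m n : nat) : 4 * n = 3 ^ m + 1 ->
  forall s j, (s * 3 ^ (j + m) + s * 3 ^ j) %% n = 0.
Proof.
move=> hn s j.
have -> : s * 3 ^ (j + m) + s * 3 ^ j = s * 3 ^ j * 4 * n.
  by rewrite -mulnA hn expnD; ring.
exact: modnMl.
Qed.

Lemma addn_modn_eq0 (n a b : nat) :
  a < n -> b < n -> 0 < a -> (a + b) %% n = 0 -> a + b = n.
Proof.
move=> an bn a0; case: (ltnP (a + b) n) => h; first by rewrite modn_small; lia.
by rewrite -[a + b](subnK h) modnDr modn_small; lia.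
Qed.

(** For j < m - 1 the power 3^j is below n and is its own residue, while 3^(m-1) has residue 2D.
    Hence no 3^j with 0 < j < m is 1, and none with j < m is -1. For j >= m, 3^j = 1 would give
    3^(j-m) = -1. *)
Lemma ordn_half (m n : nat) : odd m -> 5 <= m -> 4 * n = 3 ^ m + 1 ->
  3 ^ (2 * m) = 1 %[mod n] /\
  (forall j, 0 < j < 2 * m -> 3 ^ j <> 1 %[mod n]).
Proof.
move=> om m5 hn; have [D [nD D10 hD]] := quarter_shape _ _ om m5 hn.
have n1 : 1 %% n = 1 by rewrite modn_small //; lia.
have hm j : (3 ^ (j + m) + 3 ^ j) %% n = 0.
  by have := expn3_half_order _ _ hn 1 j; rewrite !mul1n.
have h8 : 3 ^ m.-1 %% n = 2 * D.
  by rewrite hD (_ : 8 * D + 1 = 1 * n + 2 * D) ?modnMDl ?modn_small; lia.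
have low j : j < m -> 3 ^ j %% n != 1 \/ j = 0.
  case: j => [|j] jm; [by right|left].
  case: (ltngtP j.+1 m.-1) => h; last by rewrite h h8; lia.
    have h2 : 3 * 3 ^ j.+1 <= 3 ^ m.-1 by rewrite -expnS leq_exp2l.
    have : 3 <= 3 ^ j.+1 by rewrite -{1}(expn1 3) leq_exp2l.
    by rewrite modn_small; lia.
  by lia.
have low' j : j < m -> 3 ^ j %% n != n.-1.
  move=> jm; case: (ltngtP j m.-1) => h; last by rewrite h h8; lia.
    have h2 : 3 * 3 ^ j <= 3 ^ m.-1 by rewrite -expnS leq_exp2l.
    by rewrite modn_small; lia.
  by lia.
split.
  have -> : 3 ^ (2 * m) = (3 ^ m).-1 * 4 * n + 1.
    rewrite -mulnA hn mulnC expnM; have : 0 < 3 ^ m by rewrite expn_gt0.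
    by case: (3 ^ m) => // k _; rewrite /=; ring.
  by rewrite modnMDl.
move=> j /andP[j0 j2] h; rewrite n1 in h.
case: (ltnP j m) => jm; first by case: (low j jm) => [/eqP|] ; lia.
have h0 : (1 + 3 ^ (j - m) %% n) %% n = 0.
  by rewrite modnDmr -[RHS](hm (j - m)) subnK // -[in RHS]modnDml h.
have jm' : j - m < m by rewrite ltn_subLR // addnn -mul2n.
apply/(elimN eqP (low' _ jm')).
have n0 : 0 < n by rewrite nD addn1.
have : 3 ^ (j - m) %% n < n by rewrite ltn_mod.
move: h0; move: (3 ^ (j - m) %% n) => x; clear -n0.
by case: (ltnP (1 + x) n) => hx; [rewrite modn_small | lia].
Qed.

Lemma ordn_eq (m n : nat) : odd m -> 5 <= m -> 4 * n = 3 ^ m + 1 ->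
  ordn n 3 = 2 * m.
Proof.
move=> om m5 hn; have [h1 h2] := ordn_half _ _ om m5 hn.
apply: ordn_unique => //; apply/andP; split; first by lia.
(* [ordn] searches exponents up to n only, so 2m <= n has to be checked. *)
rewrite -(leq_pmul2l (isT : 0 < 4)) hn.
have : 8 * m < 3 ^ m; last by lia.
elim: m m5 {om hn h1 h2} => // k IH; rewrite leq_eqVlt => /orP[/eqP<-//|k5].
by rewrite expnS; have := IH k5; lia.
Qed.

(* [e_j = |n - 2 x_j|], with [x_j = s 3^j mod n], satisfies [e_(j+1) = 3 e_j] mod 4
   as long as the orbit stays in the middle two thirds of [0, n]; but
   [e_m = e_0] is odd while [3^m = -1] mod 4. *)
Lemma coset_leader_bound (m n s : nat) : odd m -> 5 <= m -> 4 * n = 3 ^ m + 1 ->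
  coset_leader n 3 s -> 6 * s < n.
Proof.
move=> om m5 hn /andP[sn /allP hs].
have [D [nD D10 hD]] := quarter_shape _ _ om m5 hn.
have hM := ordn_eq _ _ om m5 hn; have [h1 _] := ordn_half _ _ om m5 hn.
rewrite ltnNge; apply/negP => hge.
pose x j := s * 3 ^ j %% n.
have xs j : s <= x j.
  by apply: hs; apply/mem_cyc_coset; rewrite ?hM //; [lia | exists j].
have xn j : x j < n by rewrite ltn_mod; lia.
have xm j : x (j + m) = n - x j.
  have := expn3_half_order _ _ hn s j; rewrite -modnDm -/(x _) -/(x _).
  by move/(addn_modn_eq0 _ _ _ (xn _) (xn _)); have := xs (j + m); clear -hge nD D10; lia.
have xsn j : x j <= n - s by have := xs (j + m); rewrite xm; have := xn j; lia.
have xS j : x j.+1 = 3 * x j %% n by rewrite /x modnMmr expnS mulnCA.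
pose e j := (n - 2 * x j) + (2 * x j - n).
(* Let k be the quotient of 3 x_j by n. If k = 1, then e_(j+1) = 3 e_j. If k is 0 or 2, the bounds
   on the orbit give e_(j+1) = 2n - 3 e_j, which is again 3 e_j mod 4 because n and e_j are odd. *)
have eS j : e j.+1 = 3 * e j %[mod 4].
  have := xs j; have := xs j.+1; have := xsn j; have := xsn j.+1.
  have n0 : 0 < n by rewrite nD addn1.
  have : 3 * x j %/ n < 3 by rewrite ltn_divLR // ltn_pmul2l.
  have := xn j.+1; have := divn_eq (3 * x j) n.
  rewrite -xS /e; move: (x j) (x j.+1) (3 * x j %/ n) => y z k.
  by clear -hge nD; case: k => [|[|[|k]]] // *; lia.
have ej j : e j = (if odd j then 3 * e 0 else e 0) %[mod 4].
  elim: j => [|j IH] //; rewrite eS -modnMmr IH modnMmr /=.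
  by clear; case: (odd j) => //=; lia.
have := ej m; rewrite om /e -[m]add0n xm.
by have := xs 0; have := xn 0; move: (x 0) => y; clear -hge nD; lia.
Qed.

Lemma coset_leader_sixth (m n D : nat) : odd m -> 5 <= m -> 4 * n = 3 ^ m + 1 ->
  n = 6 * D + 1 -> coset_leader n 3 D.
Proof.
move=> om m5 hn nD; have [D' [nD' D10 hD]] := quarter_shape _ _ om m5 hn.
have DD : D' = D by lia.
rewrite {D' nD'}DD in D10 hD.
have hM := ordn_eq _ _ om m5 hn; have [h1 _] := ordn_half _ _ om m5 hn.
apply/andP; split; first by lia.
apply/allP => y /mapP[i]; rewrite mem_iota add0n hM => /andP[_ im] ->.
(* The upper bound serves the exponents from m on, whose residues are the negatives of these. *)
have low j : j < m -> D <= D * 3 ^ j %% n <= n - D.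
  case: j => [|j] jm; first by rewrite muln1 modn_small; lia.
  have h2 : 9 * 3 ^ j <= 3 ^ m by rewrite -(expnD 3 2 j) leq_exp2l.
  have : odd (3 ^ j) by rewrite oddX orbT.
  rewrite expnS; move: (3 ^ j) h2 => p h2 op.
  have {op} [k pk] : exists k, p = 2 * k + 1 by exists p./2; clear -op; lia.
  (* Here 3D - k = (n - p) / 2, and p <= 3^m / 9 keeps it at least D. *)
  have -> : D * (3 * p) = k * n + (3 * D - k) by subst p n; nia.
  by clear -h2 hn nD D10 pk; rewrite modnMDl modn_small; lia.
case: (ltnP i m) => im'; first by case/andP: (low i im').
have /andP[l1 l2] : D <= D * 3 ^ (i - m) %% n <= n - D by apply: low; lia.
have := expn3_half_order _ _ hn D (i - m); rewrite subnK // -modnDm.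
have n0 : 0 < n by rewrite nD addn1.
have D0 : 0 < D by exact: leq_trans D10.
rewrite addnC => /addn_modn_eq0; rewrite !ltn_mod n0 (leq_trans D0 l1).
move=> /(_ isT isT isT).
by move: l1 l2; move: (_ %% n) (_ %% n) => a b; clear; lia.
Qed.

(** Both D and 3 are invertible modulo n = 6D + 1, so a repetition in the coset would give a power
    3^(j-i) = 1 with 0 < j - i < 2m. *)
Lemma sixth_coset_uniq (m n D : nat) : odd m -> 5 <= m -> 4 * n = 3 ^ m + 1 ->
  n = 6 * D + 1 -> uniq (cyc_coset n 3 D).
Proof.
move=> om m5 hn nD.
have [h1 h2] := ordn_half _ _ om m5 hn.
rewrite map_inj_in_uniq ?iota_uniq // => i j.
rewrite !mem_iota !add0n (ordn_eq _ _ om m5 hn) => /andP[_ im] /andP[_ jm] e.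
have n0 : 0 < n by rewrite nD addn1.
have co : coprime n 3 by rewrite coprime_sym prime_coprime // nD; lia.
have coD : coprime n D by rewrite coprime_sym nD /coprime gcdnMDl gcdn1.
have H i' j' : i' <= j' -> j' < 2 * m -> D * 3 ^ i' = D * 3 ^ j' %[mod n] -> i' = j'.
  move=> le lt /esym /eqP; rewrite eqn_mod_dvd ?leq_mul2l ?leq_exp2l ?le ?orbT //.
  rewrite -mulnBr Gauss_dvdr // -(subnKC le) expnD -{2}[3 ^ i']muln1 -mulnBr.
  rewrite Gauss_dvdr ?coprimeXr // -eqn_mod_dvd ?expn_gt0 // => /eqP e'.
  case: (posnP (j' - i')) => [->|p0]; first by rewrite addn0.
  by case: (h2 (j' - i')) => //; rewrite p0 (leq_ltn_trans (leq_subr _ _)).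
by case: (leqP i j) => le; [apply: H | apply/esym/H => //; exact: ltnW].
Qed.

Local Open Scope ring_scope.

(** * Generator polynomials *)

Lemma root_prod (R : idomainType) (I : Type) (s : seq I) (P : pred I)
  (p : I -> {poly R}) (x : R) :
  root (\prod_(i <- s | P i) p i) x = has (fun i => P i && root (p i) x) s.
Proof.
elim: s => [|i s IH]; first by rewrite big_nil (negbTE (root1 _)).
by rewrite big_cons /=; case: (P i); rewrite ?rootM IH.
Qed.

Lemma minpoly_neq0 (F L : fieldType) (iota : {rmorphism F -> L}) (x : L)
  (p : {poly F}) : is_minpoly iota x p -> p != 0.
Proof. by case=> /monic_neq0. Qed.

Lemma minpoly_dvdp (F L : fieldType) (iota : {rmorphism F -> L}) (x : L)
  (p r : {poly F}) : is_minpoly iota x p -> (p %| r) = root (map_poly iota r) x.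
Proof.
move=> [mp px pmin]; apply/idP/idP => [/dvdpP[u ->]|rx].
  by rewrite rmorphM rootM px orbT.
rewrite /dvdp; apply/negPn/negP => r0.
have : root (map_poly iota (r %% p)) x.
  move: rx; rewrite {1}(divp_eq r p) rmorphD rmorphM /root !hornerE.
  by rewrite (rootP px) mulr0 add0r.
by move/(pmin _ r0); rewrite leqNgt ltn_modp monic_neq0.
Qed.

(** With d the gcd, [lcmp p r] is (r/d) p, and the cofactors r/d and p/d are coprime. *)
Lemma dvdp_lcmp (F : fieldType) (p r q : {poly F}) : p != 0 -> r != 0 ->
  (lcmp p r %| q) = (p %| q) && (r %| q).
Proof.
move=> p0 r0; rewrite /lcmp; set d := gcdp p r.
have d0 : d != 0 by rewrite gcdp_eq0 negb_and p0.
have co : coprimep (r %/ d) (p %/ d).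
  by rewrite coprimep_sym coprimep_div_gcd // p0.
have pE : p = p %/ d * d by rewrite divpK ?dvdp_gcdl.
have rE : r = r %/ d * d by rewrite divpK ?dvdp_gcdr.
have lE : p * r %/ d = r %/ d * p by rewrite {1}rE mulrCA mulrA mulpK // mulrC.
rewrite lE; apply/idP/andP => [h|[/dvdpP[u ->]]].
  split; apply: dvdp_trans h; first exact: dvdp_mull.
  by rewrite {1}rE {1}pE mulrCA dvdp_mull.
by rewrite {1}rE {1}pE mulrA dvdp_mul2r // Gauss_dvdpl // => h; rewrite dvdp_mul.
Qed.

Lemma lcmp_neq0 (F : fieldType) (p r : {poly F}) : p != 0 -> r != 0 -> lcmp p r != 0.
Proof.
move=> p0 r0; have : lcmp p r %| p * r.
  by rewrite dvdp_lcmp // dvdp_mulr ?dvdp_mull.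
by apply: contraTneq => ->; rewrite dvd0p mulf_neq0.
Qed.

Lemma lcm_seq_neq0 (F : fieldType) (s : seq {poly F}) :
  all (fun p => p != 0) s -> lcm_seq s != 0.
Proof. by elim: s => [|p s IH] /=; [rewrite oner_neq0|case/andP=> /lcmp_neq0 h /IH/h]. Qed.

Lemma lcm_seq_dvdp (F : fieldType) (s : seq {poly F}) (q : {poly F}) :
  all (fun p => p != 0) s -> (lcm_seq s %| q) = all (fun p => p %| q) s.
Proof.
elim: s => [|p s IH] /=; first by rewrite dvd1p.
by case/andP=> p0 s0; rewrite dvdp_lcmp ?lcm_seq_neq0 // IH.
Qed.

(** The lcm divides the product of the list, which bounds its roots from above; each member divides
    the lcm, which gives the converse. *)
Lemma root_lcm_seq (F L : fieldType) (iota : {rmorphism F -> L})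
  (s : seq {poly F}) (x : L) : all (fun p => p != 0) s ->
  root (map_poly iota (lcm_seq s)) x = has (fun p => root (map_poly iota p) x) s.
Proof.
move=> s0; apply/idP/hasP => [h|[p ps px]].
  have : lcm_seq s %| \prod_(p <- s) p.
    rewrite lcm_seq_dvdp //; apply/allP => p ps.
    by rewrite (big_rem _ ps) dvdp_mulr.
  rewrite -(dvdp_map iota) => /dvdpP[u uE].
  have : root (map_poly iota (\prod_(p <- s) p)) x by rewrite uE rootM h orbT.
  rewrite rmorph_prod root_prod => /hasP[p ps /andP[_ px]].
  by exists p.
have : all (fun p => p %| lcm_seq s) s by rewrite -lcm_seq_dvdp.
move=> /allP/(_ _ ps)/dvdpP[u ->].
by rewrite rmorphM rootM px orbT.
Qed.

Lemma word_poly_rVpoly (F : fieldType) (n : nat) (c : 'rV[F]_n) :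
  word_poly c = rVpoly c.
Proof.
rewrite /word_poly /rVpoly poly_def; apply: eq_bigr => i _.
by rewrite insubT // => lt; congr (c _ _ *: _); exact: val_inj.
Qed.

Lemma horner_word_poly (F L : fieldType) (iota : {rmorphism F -> L}) (n : nat)
  (c : 'rV[F]_n) (x : L) :
  (map_poly iota (word_poly c)).[x] = \sum_(i < n) iota (c 0 i) * x ^+ i.
Proof.
rewrite /word_poly rmorph_sum horner_sum; apply: eq_bigr => i _.
by rewrite /= map_polyZ map_polyXn hornerZ hornerXn.
Qed.

(** * Frobenius descent and conjugate roots *)

(** Such a [c] is a root of X^q - X, which is the product of the X - a for a in F. *)
Lemma fixed_by_frobenius (F : finFieldType) (L : fieldType)
  (iota : {rmorphism F -> L}) (c : L) : c ^+ #|F| = c -> exists a, c = iota a.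
Proof.
move=> hc; have : root (map_poly iota ('X^#|F| - 'X)) c.
  by rewrite rmorphB /= map_polyXn map_polyX /root !hornerE hc subrr.
rewrite finField_genPoly rmorph_prod root_prod => /hasP[a _ /andP[_]].
by rewrite /= map_polyXsubC root_XsubC => /eqP; exists a.
Qed.

Lemma descend_poly (F : finFieldType) (L : fieldType)
  (iota : {rmorphism F -> L}) (P : {poly L}) :
  (forall k, P`_k ^+ #|F| = P`_k) -> exists r, map_poly iota r = P.
Proof.
move=> hP; have /fin_all_exists[f hf] (k : 'I_(size P)) : exists a, P`_k = iota a.
  exact: fixed_by_frobenius.
exists (rVpoly (\row_k f k)); apply/polyP => k; rewrite coef_map /=.
case: (ltnP k (size P)) => hk; last by rewrite [RHS]nth_default // nth_default ?rmorph0 //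
  (leq_trans (size_poly _ _)).
by rewrite (coef_rVpoly_ord _ (Ordinal hk)) mxE -hf.
Qed.

(* The product of [X - beta^(i q^j)] over a full period is Frobenius invariant,
   so it descends to [F]. *)
Lemma minpoly_roots (F L : finFieldType) (iota : {rmorphism F -> L}) (n M i : nat)
  (beta x : L) (p : {poly F}) : prime #|F| -> n.-primitive_root beta ->
  (0 < M)%N -> (#|F| ^ M = 1 %[mod n])%N -> is_minpoly iota (beta ^+ i) p ->
  root (map_poly iota p) x <-> exists j, x = beta ^+ (i * #|F| ^ j).
Proof.
move=> pq pb M0 hM hp; have [_ pi _] := hp.
have chF : #|F| \in [pchar F] by apply: (@card_finPcharP _ _ 1); rewrite ?expn1.
have chL : #|F| \in [pchar L] by rewrite (fmorph_pchar iota).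
(* The prime [#|F|] is the characteristic of L, so this power map is a ring morphism. *)
have [fr frE] : exists fr : {rmorphism L -> L}, forall y, fr y = y ^+ #|F|.
  by exists (pFrobenius_aut chL) => y; exact: pFrobenius_autE.
split=> [px|[j ->]]; last first.
  elim: j => [|j IH]; first by rewrite muln1.
  have -> : map_poly iota p = map_poly fr (map_poly iota p).
    apply/polyP => k; rewrite !coef_map /= frE -rmorphXn; congr (iota _).
    by rewrite expf_card.
  by rewrite expnSr mulnA exprM -frE rmorph_root.
pose P := \prod_(j < M) ('X - (beta ^+ (i * #|F| ^ j))%:P).
have frP : map_poly fr P = P.
  rewrite /P rmorph_prod /=; case: M M0 hM @P => // M _ hM _.
  (* Frobenius sends factor j to factor j + 1; the last one wraps around to factor 0 since q^M = 1
     mod n. *)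
  rewrite big_ord_recr [RHS]big_ord_recl [LHS]mulrC /=; congr (_ * _).
    rewrite /= map_polyXsubC frE -exprM -mulnA -expnSr; congr ('X - _%:P).
    apply/eqP; rewrite (eq_prim_root_expr pb) -modnMmr hM modnMmr.
    by rewrite expn0.
  apply: eq_bigr => j _; rewrite /= map_polyXsubC frE -exprM -mulnA -expnSr.
  by rewrite /bump /= add1n.
have [r rP] : exists r, map_poly iota r = P.
  by apply: descend_poly => k; rewrite -frE -{2}frP coef_map.
have : p %| r.
  rewrite (minpoly_dvdp _ _ _ _ _ _ hp) rP /P root_prod; apply/hasP.
  exists (Ordinal M0); rewrite ?mem_index_enum //= expn0 muln1.
  by rewrite root_XsubC.
rewrite -(dvdp_map iota) rP => /dvdpP[u uE].
have : root P x by rewrite uE rootM px orbT.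
rewrite root_prod => /hasP[j _ /andP[_]]; rewrite root_XsubC => /eqP ->.
by exists j.
Qed.

(** * Cyclic codes *)

(** Over L, X^n - 1 splits into distinct linear factors, so a divisor is the product of a subfamily;
    that subfamily is then identified by the roots of [g]. *)
Lemma dvdp_Xn_sub_1_factors (F L : fieldType) (f : {rmorphism F -> L}) (n : nat)
  (beta : L) (g : {poly F}) : n.-primitive_root beta -> g %| 'X^n - 1 ->
  map_poly f g %= \prod_(s <- iota 0 n | root (map_poly f g) (beta ^+ s))
    ('X - (beta ^+ s)%:P).
Proof.
move=> pb; rewrite -(dvdp_map f) rmorphB /= map_polyXn rmorph1.
rewrite -(factor_Xn_sub_1 pb) /index_iota subn0 => /dvdp_prod_XsubC[m gm].
apply: (eqp_trans gm); rewrite -[in X in _ %= X]big_filter.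
set r := [seq s <- _ | _]; suff pe : perm_eq (mask m (iota 0 n)) r.
  by rewrite (perm_big _ pe) eqpxx.
apply: uniq_perm; rewrite ?filter_uniq ?mask_uniq ?iota_uniq // => s.
have rg x : root (map_poly f g) x = has (fun s => x == beta ^+ s) (mask m (iota 0 n)).
  by rewrite (eqp_root gm) root_prod; apply: eq_has => i; rewrite root_XsubC.
rewrite mem_filter rg; apply/idP/andP => [sm|[/hasP[j jm /eqP e] si]].
  by split; [apply/hasP; exists s | exact: mem_mask sm].
move: (mem_mask jm) si; rewrite !mem_iota !add0n /= => jn sn.
by move/eqP: e; rewrite (eq_prim_root_expr pb) !modn_small // => /eqP ->.
Qed.

(** A divisor of X^n - 1 has only simple roots, so inclusion of roots implies divisibility. *)
Lemma dvdp_by_roots (F L : fieldType) (f : {rmorphism F -> L}) (n : nat)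
  (beta : L) (g w : {poly F}) : n.-primitive_root beta -> g %| 'X^n - 1 ->
  (forall s, (s < n)%N -> root (map_poly f g) (beta ^+ s) ->
    root (map_poly f w) (beta ^+ s)) -> g %| w.
Proof.
move=> pb gX hw; rewrite -(dvdp_map f) (eqp_dvdl _ (dvdp_Xn_sub_1_factors _ _ _ _ _ _ pb gX)).
rewrite -big_filter -(big_map (fun s => beta ^+ s) xpredT (fun z => 'X - z%:P)).
apply: uniq_roots_dvdp.
  apply/allP => z /mapP[s]; rewrite mem_filter mem_iota => /andP[rs sn] ->.
  exact: hw.
rewrite uniq_rootsE map_inj_in_uniq ?filter_uniq ?iota_uniq // => i j.
rewrite !mem_filter !mem_iota !add0n /= => /andP[_ hi] /andP[_ hj] /eqP.
by rewrite (eq_prim_root_expr pb) !modn_small // => /eqP.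
Qed.

Lemma size_dvdp_Xn_sub_1 (F L : fieldType) (f : {rmorphism F -> L}) (n : nat)
  (beta : L) (g : {poly F}) : n.-primitive_root beta -> g %| 'X^n - 1 ->
  size g = (count (fun s => root (map_poly f g) (beta ^+ s)) (iota 0 n)).+1.
Proof.
move=> pb gX; rewrite -(size_map_poly f).
rewrite (eqp_size (dvdp_Xn_sub_1_factors _ _ _ _ _ _ pb gX)) -big_filter.
by rewrite size_prod_XsubC size_filter.
Qed.

(** Multiplication by [g] maps the polynomials of degree below n - deg g bijectively onto the
    code. *)
Lemma card_cyclic_code (F : finFieldType) (n : nat) (g : {poly F}) :
  g != 0 -> (size g <= n.+1)%N -> #|cyclic_code n g| = (#|F| ^ (n.+1 - size g))%N.
Proof.
move=> g0 sg; set k := (n.+1 - size g)%N.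
have sk (u : 'rV[F]_k) : (size (rVpoly u * g)%R <= n)%N.
  apply: leq_trans (size_polyMleq _ _) _.
  have : (size (rVpoly u) <= k)%N by exact: size_poly.
  by have := g0; rewrite -size_poly_gt0 /k; lia.
pose enc (u : 'rV[F]_k) : 'rV[F]_n := poly_rV (rVpoly u * g).
have encE u : rVpoly (enc u) = rVpoly u * g by rewrite poly_rV_K.
have -> : cyclic_code n g = enc @: [set: 'rV[F]_k].
  apply/setP => c; rewrite inE word_poly_rVpoly.
  apply/idP/imsetP => [/dvdpP[u uE]|[u _ ->]]; last by rewrite encE dvdp_mull.
  exists (poly_rV u) => //; rewrite /enc poly_rV_K -?uE ?rVpolyK //.
  have [-> | u0] := eqVneq u 0; first by rewrite size_poly0.
  have : (size (rVpoly c) <= n)%N by exact: size_poly.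
  rewrite uE size_mul //.
  by rewrite /k leq_subRL // -subn1 leq_subLR add1n addnC.
rewrite card_imset ?cardsT ?card_mx ?mul1n // => u v /(congr1 rVpoly).
by rewrite !encE => /(mulIf g0)/(congr1 (@poly_rV F k)); rewrite !rVpolyK.
Qed.

(* Test the syndromes against the polynomial of degree [wt c - 1] vanishing at
   all but one of the locators of the support of [c]. *)
Lemma bch_bound (F L : fieldType) (f : {rmorphism F -> L}) (n d b : nat)
  (beta : L) (c : 'rV[F]_n) : n.-primitive_root beta ->
  (forall k, (k < d)%N -> root (map_poly f (word_poly c)) (beta ^+ (b + k))) ->
  c != 0 -> (d < wt c)%N.
Proof.
move=> pb hc c0; rewrite ltnNge; apply/negP => wd.
have [i0 ci0] : exists i0, c 0 i0 != 0.
  apply/existsP; apply: contraNT c0 => /existsPn h; apply/eqP/rowP => i.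
  by rewrite mxE; apply/eqP/negPn/h.
pose S := [set i | c 0 i != 0].
have iS : i0 \in S by rewrite inE.
pose h := \prod_(i in S :\ i0) ('X - (beta ^+ i)%:P).
have sh : (size h <= d)%N.
  apply: leq_trans wd; rewrite /h -big_enum size_prod_XsubC -cardE.
  by rewrite [X in (_ <= X)%N](cardsD1 i0 S) iS.
(* Expanding [h] into its coefficients turns the sum into a combination of the d vanishing
   syndromes, enough because h has size at most d. *)
have e0 : \sum_(i < n) f (c 0 i) * beta ^+ (b * i) * h.[beta ^+ i] = 0.
  transitivity (\sum_(k < d) h`_k * (map_poly f (word_poly c)).[beta ^+ (b + k)]).
    rewrite (eq_bigr (fun i : 'I_n => \sum_(k < d)
      h`_k * (f (c 0 i) * beta ^+ (b + k) ^+ i))) => [|i _].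
      rewrite exchange_big; apply: eq_bigr => k _.
      by rewrite horner_word_poly mulr_sumr.
    rewrite (horner_coef_wide _ sh) mulr_sumr; apply: eq_bigr => k _.
    by rewrite -!exprM mulnDl exprD [(i * k)%N]mulnC; ring.
  by rewrite big1 // => k _; rewrite (rootP (hc k _)) ?mulr0.
(* Only the term of [i0] survives, and none of its factors is zero. *)
move: e0; rewrite (bigD1 i0) //= big1 ?addr0 => [|i ii0].
  move/eqP; rewrite !mulf_eq0 fmorph_eq0 (negbTE ci0) expf_eq0 /=.
  rewrite (prim_root_eq0 pb) -[n == 0%N]negbK -lt0n (leq_ltn_trans _ (ltn_ord i0)) // andbF /=.
  rewrite -/(root h _) root_prod => /hasP[i _]; rewrite inE root_XsubC in_set1.
  case/andP=> /andP[/negP ii0 _]; rewrite (eq_prim_root_expr pb) !modn_small // => e.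
  by apply: ii0; rewrite eq_sym -val_eqE.
have [ci|ci] := eqVneq (c 0 i) 0; first by rewrite ci rmorph0 !mul0r.
rewrite [h.[_]](rootP _) ?mulr0 // root_prod; apply/hasP; exists i.
  exact: mem_index_enum.
by rewrite !inE ii0 ci root_XsubC eqxx.
Qed.

(* For [y] in the code, the words orthogonal to all cyclic shifts of [y] satisfy
   [c(beta^s) y(beta^-s) = 0] for all [s]; take [y = g]. *)
Lemma cyclic_code_LCD (F : finFieldType) (L : fieldType) (f : {rmorphism F -> L})
  (n : nat) (beta : L) (g : {poly F}) : n.-primitive_root beta -> g %| 'X^n - 1 ->
  (forall s, root (map_poly f g) (beta ^+ s) ->
    root (map_poly f g) (beta ^+ (s * n.-1))) ->
  is_LCD (cyclic_code n g).
Proof.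
move=> pb gX gs; apply/setP => c; rewrite !inE; apply/andP/eqP; last first.
  move=> ->; split; first by rewrite word_poly_rVpoly linear0 dvdp0.
  by apply/forall_inP => x _; rewrite /dotw big1 // => i _; rewrite mxE mulr0.
case=> gc /forall_inP cd.
have n0 : (0 < n)%N := prim_order_gt0 pb.
have cs s : root (map_poly f (word_poly c)) (beta ^+ s).
  case: (boolP (root (map_poly f g) (beta ^+ s))) => gs0.
    by move/dvdpP: gc => [u ->]; rewrite rmorphM rootM gs0 orbT.
  (* The exponent [t] stands for -s; applying [gs] at [t] leads back to [s]. *)
  pose t := (s * n.-1)%N.
  have gt0 : ~~ root (map_poly f g) (beta ^+ t).
    apply: contraNN gs0 => /gs.
    have -> : beta ^+ (t * n.-1) = beta ^+ s; last by [].
      apply/eqP; rewrite (eq_prim_root_expr pb) -(eqn_modDr t) -mulnSr.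
      by rewrite [(s + _)%N]addnC -mulnSr prednK // !modnMl.
  (* With n in successor form, addition on the index type is addition modulo n, so index shifts are
     cyclic. *)
  case: n n0 {gs} pb gX c cd {gc} @t gt0 => // p _ pb gX c cd t gt0.
  (* The reduction makes [g] fit into length n, even when g is X^n - 1 up to a constant, and keeps
     its values at the powers of [beta]. *)
  pose y0 : 'rV[F]_p.+1 := poly_rV (g %% ('X^(p.+1) - 1)).
  have y0E s' : (map_poly f (word_poly y0)).[beta ^+ s'] = (map_poly f g).[beta ^+ s'].
    rewrite word_poly_rVpoly poly_rV_K; last first.
      by rewrite -ltnS -(size_Xn_sub_1 F (isT : 0 < p.+1)%N) ltn_modp -size_poly_gt0 size_Xn_sub_1.
    rewrite {2}(divp_eq g ('X^(p.+1) - 1)) rmorphD rmorphM rmorphB /=.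
    rewrite map_polyXn rmorph1 !hornerE -exprM mulnC exprM (prim_expr_order pb).
    by rewrite expr1n subrr mulr0 add0r.
  have shift (h : 'I_p.+1 -> L) (k : 'I_p.+1) s' :
    beta ^+ (s' * k) * (\sum_(i < p.+1) h (i + k) * beta ^+ (s' * i)) =
    \sum_(i < p.+1) h i * beta ^+ (s' * i).
    rewrite [RHS](reindex_inj (addIr k)) /= mulr_sumr; apply: eq_bigr => i _.
    rewrite mulrCA -exprD -mulnDr; congr (_ * _).
    by apply/eqP; rewrite (eq_prim_root_expr pb) modnMmr addnC.
  pose y k : 'rV[F]_p.+1 := \row_i y0 0 (i + k).
  have yC k : y k \in cyclic_code p.+1 g.
    rewrite inE; apply: (dvdp_by_roots _ _ f _ _ _ _ pb gX) => s' _ rs'.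
    have bk : beta ^+ (s' * k) != 0 by rewrite expf_neq0 // (prim_root_eq0 pb).
    rewrite /root -(mulrI_eq0 _ (mulfI bk)) horner_word_poly.
    rewrite (eq_bigr (fun i => f (y0 0 (i + k)) * beta ^+ (s' * i))) => [|i _]; last first.
      by rewrite mxE exprM.
    rewrite (shift (fun i => f (y0 0 i))) (eq_bigr (fun i => f (y0 0 i) * (beta ^+ s') ^+ i)) => [|i _]; last first.
      by rewrite exprM.
    by rewrite -horner_word_poly y0E.
  (* This product is the Fourier transform of the cyclic correlation of [c] with [y0], whose entries
     are the dot products of [c] with the shifts [y k]. *)
  have : (map_poly f (word_poly c)).[beta ^+ s] * (map_poly f g).[beta ^+ t] = 0.
    rewrite -y0E !horner_word_poly mulr_suml.
    transitivity (\sum_(k < p.+1) beta ^+ (t * k) * f (dotw (y k) c)); last first.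
      by rewrite big1 // => k _; rewrite (eqP (cd _ (yC k))) rmorph0 mulr0.
    transitivity (\sum_(i < p.+1) \sum_(k < p.+1)
       beta ^+ (t * k) * (f (y0 0 (i + k)) * f (c 0 i))).
      apply: eq_bigr => i _.
      rewrite (eq_bigr (fun j : 'I_p.+1 => f (y0 0 j) * beta ^+ (t * j))); last first.
        by move=> j _; rewrite exprM.
      rewrite -(shift (fun j => f (y0 0 j)) i t) mulrA -[_ * _ * _ ^+ (t * i)]mulrA.
      have -> : (beta ^+ s) ^+ i * beta ^+ (t * i) = 1.
        rewrite -exprM -exprD -mulnDl addnC -mulnSr -mulnA mulnCA exprM.
        by rewrite (prim_expr_order pb) expr1n.
      rewrite mulr1 mulr_sumr.
      by apply: eq_bigr => k _; rewrite [k + i]addrC; ring.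
    rewrite exchange_big; apply: eq_bigr => k _.
    rewrite rmorph_sum mulr_sumr; apply: eq_bigr => i _.
    by rewrite rmorphM [y k 0 i]mxE.
  by move/eqP; rewrite mulf_eq0 => /orP[//|]; rewrite -/(root _ _) (negbTE gt0).
(* A nonzero polynomial of degree below n cannot have the n distinct powers of [beta] as roots. *)
have : word_poly c == 0.
  apply: contraT => w0.
  have := @max_poly_roots _ (map_poly f (word_poly c)) [seq beta ^+ s | s <- iota 0 n].
  rewrite map_poly_eq0 w0 => /(_ isT) h.
  have : (n < size (word_poly c))%N.
    rewrite -(size_map_poly f); have := h; rewrite size_map size_iota; apply.
      by apply/allP => z /mapP[s _ ->].
    rewrite map_inj_in_uniq ?iota_uniq // => i j.
    rewrite !mem_iota !add0n /= => hi hj /eqP.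
    by rewrite (eq_prim_root_expr pb) !modn_small // => /eqP.
  by rewrite word_poly_rVpoly ltnNge size_poly.
rewrite word_poly_rVpoly => /eqP/(congr1 (@poly_rV F n)).
by rewrite rVpolyK linear0.
Qed.

(** * The BCH codes of length (3^m+1)/4 *)

Lemma coset_sym (n q M r s j : nat) : (0 < M)%N -> (q ^ M = 1 %[mod n])%N ->
  (s = r * q ^ j %[mod n])%N -> exists k, (r = s * q ^ k %[mod n])%N.
Proof.
move=> M0 hM e; exists (j * M.-1)%N.
rewrite -modnMml e modnMml -mulnA -expnD -mulnS prednK // -modnMmr.
by rewrite (expn_mod_order _ _ _ _ hM) modnMl expn0 modnMmr muln1.
Qed.

Lemma delta1_sixth (m n D : nat) : odd m -> (5 <= m)%N -> (4 * n = 3 ^ m + 1)%N ->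
  (n = 6 * D + 1)%N -> delta_ 1 n 3 = D.
Proof.
move=> om m5 hn nD.
have DM : D \in MinRep n 3.
  by rewrite mem_filter (coset_leader_sixth m) //= mem_iota; lia.
have ne : MinRep n 3 != [::] by apply: contraTneq DM => ->.
have le := delta1_max n 3 D DM.
have := delta1_mem n 3 ne; rewrite mem_filter => /andP[].
move=> /(coset_leader_bound _ _ _ om m5 hn) h _.
by move: h le; rewrite nD; lia.
Qed.

Lemma root_bch (F L : finFieldType) (f : {rmorphism F -> L}) (n M b k : nat)
  (beta x : L) (mp : nat -> {poly F}) : prime #|F| -> n.-primitive_root beta ->
  (0 < M)%N -> (#|F| ^ M = 1 %[mod n])%N ->
  (forall i, is_minpoly f (beta ^+ i) (mp i)) ->
  root (map_poly f (lcm_seq [seq mp i | i <- iota b k])) x <->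
  exists i j, (b <= i < b + k)%N /\ x = beta ^+ (i * #|F| ^ j).
Proof.
move=> pq pb M0 hM hmp; rewrite root_lcm_seq; last first.
  by apply/allP => p /mapP[i _ ->]; exact: minpoly_neq0 (hmp i).
split=> [/hasP[p /mapP[i]]|[i [j [ik xE]]]].
  rewrite mem_iota => ik -> /(minpoly_roots _ _ _ _ _ _ _ _ _ pq pb M0 hM (hmp i))[j ->].
  by exists i, j.
apply/hasP; exists (mp i); first by apply: map_f; rewrite mem_iota.
by apply/(minpoly_roots _ _ _ _ _ _ _ _ _ pq pb M0 hM (hmp i)); exists j.
Qed.

Lemma bch_dvdp_Xn_sub_1 (F L : finFieldType) (f : {rmorphism F -> L}) (n : nat)
  (beta : L) (mp : nat -> {poly F}) (s : seq nat) : n.-primitive_root beta ->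
  (forall i, is_minpoly f (beta ^+ i) (mp i)) ->
  lcm_seq [seq mp i | i <- s] %| 'X^n - 1.
Proof.
move=> pb hmp; rewrite lcm_seq_dvdp; last first.
  by apply/allP => p /mapP[i _ ->]; exact: minpoly_neq0 (hmp i).
apply/allP => p /mapP[i _ ->]; rewrite (minpoly_dvdp _ _ _ _ _ _ (hmp i)).
rewrite rmorphB /= map_polyXn rmorph1 /root !hornerE -exprM mulnC exprM.
by rewrite (prim_expr_order pb) expr1n subrr.
Qed.

(** Since q^h = -1 mod n, each coset contains the negatives of its elements, so the zeros are stable
    under inversion. *)
Lemma bch_code_LCD (F L : finFieldType) (f : {rmorphism F -> L}) (n M h b delta : nat)
  (beta : L) (mp : nat -> {poly F}) : prime #|F| -> n.-primitive_root beta ->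
  (0 < M)%N -> (#|F| ^ M = 1 %[mod n])%N -> (n %| #|F| ^ h + 1)%N ->
  (forall i, is_minpoly f (beta ^+ i) (mp i)) ->
  is_LCD (bch_code n mp delta b).
Proof.
move=> pq pb M0 hM hh hmp.
apply: (cyclic_code_LCD _ _ f _ _ _ pb (bch_dvdp_Xn_sub_1 _ _ _ _ _ _ _ pb hmp)) => s.
have n0 := prim_order_gt0 pb.
move=> /(root_bch _ _ _ _ _ _ _ _ _ _ pq pb M0 hM hmp)[i [j [ib e]]].
apply/(root_bch _ _ _ _ _ _ _ _ _ _ pq pb M0 hM hmp); exists i, (j + h)%N; split=> //.
rewrite exprM e -exprM; apply/eqP; rewrite (eq_prim_root_expr pb).
rewrite -(eqn_modDr (i * #|F| ^ j)) -mulnSr prednK // modnMl.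
have -> : (i * #|F| ^ (j + h) + i * #|F| ^ j = i * #|F| ^ j * (#|F| ^ h + 1))%N.
  by rewrite expnD; ring.
by rewrite eq_sym; exact: dvdn_mull.
Qed.

(** The list [T] enumerates the exponents that are not zeros of the code; their number is n minus
    the degree of the generator. *)
Lemma bch_code_dim (F L : finFieldType) (f : {rmorphism F -> L}) (n b delta : nat)
  (beta : L) (mp : nat -> {poly F}) (T : seq nat) : n.-primitive_root beta ->
  (forall i, is_minpoly f (beta ^+ i) (mp i)) -> uniq T ->
  (forall s, s \in T <-> (s < n)%N /\
     ~ root (map_poly f (lcm_seq [seq mp i | i <- iota b (delta - 1)])) (beta ^+ s)) ->
  has_dim (bch_code n mp delta b) (size T).
Proof.
move=> pb hmp uT hT; have gX := bch_dvdp_Xn_sub_1 _ _ _ _ _ _ (iota b (delta - 1)) pb hmp.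
rewrite /has_dim /bch_code; set g := lcm_seq _ in hT gX *.
have sg := size_dvdp_Xn_sub_1 _ _ f _ _ _ pb gX.
pose a s := root (map_poly f g) (beta ^+ s).
have ca := count_predC a (iota 0 n); rewrite size_iota in ca.
have <- : count (predC a) (iota 0 n) = size T.
  rewrite -size_filter; apply/perm_size/uniq_perm; rewrite ?filter_uniq ?iota_uniq //.
  move=> s; rewrite mem_filter mem_iota add0n /=.
  by apply/andP/idP => [[/negP ? ?]|/hT[? /negP ?]] //; apply/hT.
rewrite card_cyclic_code -?size_poly_gt0 sg //; last by rewrite ltnS -[X in (_ <= X)%N]ca leq_addr.
by rewrite subSS -[X in (X - _)%N]ca addKn.
Qed.

Theorem theorem8 (t : nat) (ht : (2 <= t)%N)
  (F : finFieldType) (hF : #|F| = 3%N)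
  (L : finFieldType) (iota : {rmorphism F -> L})
  (hL : #|L| = (3 ^ ordn ((3 ^ (2 * t + 1) + 1) %/ 4) 3)%N)
  (alpha : L) (halpha : (#|L|.-1).-primitive_root alpha)
  (mp : nat -> {poly F})
  (hmp : forall i : nat,
      is_minpoly iota ((alpha ^+ ((#|L|.-1) %/ ((3 ^ (2 * t + 1) + 1) %/ 4))) ^+ i) (mp i))
  (delta : nat) :
  let m := (2 * t + 1)%N in
  let n := ((3 ^ m + 1) %/ 4)%N in
  (delta_ 2 n 3 + 1 <= delta <= delta_ 1 n 3)%N ->
  [/\ is_LCD (bch_code n mp delta 1),
      has_dim (bch_code n mp delta 1) (2 * m + 1) &
      min_dist_ge (bch_code n mp delta 1) (delta_ 2 n 3)] /\
  [/\ is_LCD (bch_code n mp (delta + 1) 0),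
      has_dim (bch_code n mp (delta + 1) 0) (2 * m) &
      min_dist_ge (bch_code n mp (delta + 1) 0) (2 * delta_ 2 n 3)].
Proof.
move=> m n.
rewrite -/m -/n in hL hmp.
have om : odd m by rewrite /m addn1 oddS oddM.
have m5 : (5 <= m)%N by rewrite /m; lia.
have hn : (4 * n = 3 ^ m + 1)%N.
  have d4 : (4 %| 3 ^ m + 1)%N.
    rewrite /m mul2n addn1; elim: (t) => // k IH.
    by move: IH; rewrite doubleS !expnS; move: (3 ^ _)%N => z; lia.
  by rewrite mulnC /n divnK.
clearbody n m => {ht t}.
have [D [nD D10 _]] := quarter_shape _ _ om m5 hn.
have hM := ordn_eq _ _ om m5 hn; have [h1 _] := ordn_half _ _ om m5 hn.
have n0 : (0 < n)%N by rewrite nD addn1.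
have M0 : (0 < 2 * m)%N by lia.
have d1 := delta1_sixth _ _ _ om m5 hn nD.
rewrite d1 => /andP[dl2 dl1].
set beta := alpha ^+ _ in hmp.
have pb : n.-primitive_root beta.
  apply: dvdn_prim_root => //; rewrite hL hM -subn1 -eqn_mod_dvd ?expn_gt0 //.
  by apply/eqP.
have pq : prime #|F| by rewrite hF.
have h1F : (#|F| ^ (2 * m) = 1 %[mod n])%N by rewrite hF.
have nm : (n %| #|F| ^ m + 1)%N by rewrite hF -hn dvdn_mull.
have rootE b k x := root_bch _ _ iota _ _ b k _ x _ pq pb M0 h1F hmp.
have memD x : x \in cyc_coset n 3 D <-> exists i, x = (D * 3 ^ i %% n)%N.
  by split => [/mem_cyc_coset|e]; [|apply/mem_cyc_coset]; rewrite ?hM //; apply.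
have /andP[_ /allP Dmin] := coset_leader_sixth _ _ _ om m5 hn nD.
(* A zero in the coset of D would put some i < delta <= D into that coset, against the minimality of
   D. *)
have rootN b k s : (b + k <= delta)%N -> s \in cyc_coset n 3 D ->
    ~ root (map_poly iota (lcm_seq [seq mp i | i <- seq.iota b k])) (beta ^+ s).
  move=> bk /memD[h sh] /rootE[i [j [/andP[_ ib] /eqP]]].
  rewrite (eq_prim_root_expr pb) hF sh modn_mod => /eqP e.
  have [l] := coset_sym _ _ _ _ _ _ M0 h1 e.
  rewrite -mulnA -expnD modn_small; last by clear -bk ib dl1 nD; lia.
  move=> iE; have : (D <= i)%N by apply/Dmin/memD; exists (h + l)%N.
  by clear -bk ib dl1; lia.
(* The leader of such a coset is neither 0 nor the largest leader D, so it is at most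
   [delta_ 2 n 3], hence below [delta]. *)
have rootY s : (s < n)%N -> s \notin cyc_coset n 3 D -> s != 0%N ->
    exists i j, (1 <= i < delta)%N /\ beta ^+ s = beta ^+ (i * #|F| ^ j).
  move=> sn sD s0.
  have [||r rM [j sE]] := coset_leader_exists n 3 s n0; rewrite ?hM //.
  rewrite modn_small // in sE.
  exists r, j; split; last first.
    by apply/eqP; rewrite (eq_prim_root_expr pb) hF sE modn_mod.
  have r0 : r != 0%N by apply: contraNneq s0 => r0; rewrite sE r0 mul0n mod0n.
  have rD : r != delta_ 1 n 3.
    by apply: contraNneq sD; rewrite d1 => rD; apply/memD; exists j; rewrite sE rD.
  by have := delta2_max _ _ _ rM rD; clear -r0 dl2; lia.
have uD := sixth_coset_uniq _ _ _ om m5 hn nD.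
have sD : size (cyc_coset n 3 D) = (2 * m)%N by rewrite size_map size_iota hM.
have ltD s : s \in cyc_coset n 3 D -> (s < n)%N by move/memD => [i ->]; rewrite ltn_mod.
have zero : 0%N \notin cyc_coset n 3 D by apply/negP => /Dmin; rewrite leqNgt (leq_trans _ D10).
split; split.
- exact: bch_code_LCD pq pb M0 h1F nm hmp.
- have -> : (2 * m + 1)%N = size (0%N :: cyc_coset n 3 D) by rewrite addn1 -sD.
  apply: (bch_code_dim _ _ _ _ _ _ _ _ _ pb hmp) => [|s]; first by rewrite cons_uniq zero.
  rewrite inE; split=> [/orP[/eqP ->|sC]|[sn sr]].
  + split=> // /rootE[i [j [ib /eqP]]].
    rewrite (eq_prim_root_expr pb) hF => /eqP e.
    have [l] := coset_sym _ _ _ _ _ _ M0 h1 e.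
    by rewrite mul0n mod0n modn_small; clear -ib dl1 dl2 nD; lia.
  + by split; [exact: ltD | apply: rootN => //; clear -dl2; lia].
  apply/orP; case: (boolP (s \in _)) => sC; [by right | left].
  apply/negPn/negP => s0; apply: sr; apply/rootE.
  by have [i [j [ij e]]] := rootY s sn sC s0; exists i, j; split=> //; clear -ij; lia.
- move=> c; rewrite inE => /dvdpP[u cE] c0.
  suff : (delta - 1 < wt c)%N by clear -dl2; lia.
  apply: (bch_bound _ _ iota _ _ 1 _ _ pb) => // k kd.
  rewrite cE rmorphM rootM; apply/orP; right.
  by apply/rootE; exists (1 + k)%N, 0%N; rewrite muln1; split=> //; clear -kd; lia.
- exact: bch_code_LCD pq pb M0 h1F nm hmp.
- rewrite -sD; apply: (bch_code_dim _ _ _ _ _ _ _ _ _ pb hmp) => // s.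
  split=> [sC|[sn sr]]; first by split; [exact: ltD | apply: rootN => //; clear -dl2; lia].
  apply/negPn/negP => sC; apply: sr; apply/rootE.
  have [s0|s0] := eqVneq s 0%N; first by exists 0%N, 0%N; rewrite s0; split=> //; clear -dl2; lia.
  by have [i [j [ij e]]] := rootY s sn sC s0; exists i, j; split=> //; clear -ij; lia.
- move=> c; rewrite inE => /dvdpP[u cE] c0.
  suff : ((2 * delta).-1 < wt c)%N by clear -dl2; lia.
  (* The zeros have exponents from -(delta - 1) to delta - 1, that is 2 delta - 1 in a row; the
     start is taken modulo n. *)
  apply: (bch_bound _ _ iota _ _ (n - (delta - 1)) _ _ pb) => // k kd.
  rewrite cE rmorphM rootM; apply/orP; right; apply/rootE.
  have [dk|dk] := leqP (delta - 1) k.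
    exists (k - (delta - 1))%N, 0%N; split; first by clear -kd dk dl2; lia.
    apply/eqP; rewrite (eq_prim_root_expr pb) muln1.
    by rewrite (_ : n - (delta - 1) + k = n + (k - (delta - 1)))%N ?modnDl //; clear -dk dl1 nD; lia.
  (* The exponent is -(delta - 1 - k), and the factor 3^m = -1 provides the sign. *)
  exists (delta - 1 - k)%N, m; split; first by clear -dk dl2; lia.
  apply/eqP; rewrite (eq_prim_root_expr pb) -(eqn_modDr (delta - 1 - k)).
  rewrite -{3}[(delta - 1 - k)%N]muln1 -mulnDr.
  rewrite (_ : n - (delta - 1) + k + (delta - 1 - k) = n)%N; last by clear -dk dl1 nD; lia.
  by rewrite modnn eq_sym; exact: dvdn_mull.
Qed.
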